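(* Let $k\geq 2$ be an integer. Then, as an identity between formal power series, $$\log G_k=\hat G_k^{\min},$$ where $G_k(x)=1+\sum_{n\geq 1}\frac{x^n}{n}\binom{kn}{n-1}$ and $\hat G_k^{\min}(x)=\sum_{n\geq 1}\frac{x^n}{n!}\,|\mathscr T_k^{\min}(n)|$ is the exponential generating function for root-minimal plane $k$-ary trees with vertex set $[n]$.
   Context: Here $\mathbb N=\{1,2,3,\dots\}$ and $[n]=\{1,\dots,n\}$. The logarithm of a formal power series with constant term $1$ is the usual formal logarithm. Rooted plane $k$-ary trees: let $k\ge2$ and let $V\subset\mathbb N$ be finite. A rooted plane $k$-ary tree with vertex set $V$ is a quadruple $(V,E,r,(\ell(v))_{v\in V})$ such that (1) $r\in V$ and $E\subset\binom V2$; (2) $(V,E,r)$ is a tree rooted in $r$; (3) for each $v\in V$, the set $C(v)\subset V$ of children of $v$ satisfies $|C(v)|\le k$; (4) for each $v\in V$, $\ell(v):C(v)\to\{1,\dots,k\}$ is an injective map. The $p$-th $v$-slot is said to be occupied by $j$ if $j\in C(v)$ and $\ell(v)(j)=p$, and is vacant if there is no such $j$. The set of these trees is denoted $\mathscr T_k(V)$. Root-minimal trees: for $t\in\mathscr T_k(V)$ with root $r$, the set $B\subset V$ of vertices on the rightmost branch of $t$ is defined inductively: $r\in B$; and if $v\in B$ then the vertex occupying the $k$-th (rightmost) $v$-slot, if there is one, is in $B$. The tree $t$ is root-minimal if $r$ is smaller (in the usual order on $\mathbb N$) than every other vertex on the rightmost branch. The set of root-minimal trees is denoted $\mathscr T_k^{\min}(V)$,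 and $\mathscr T_k^{\min}(n):=\mathscr T_k^{\min}([n])$. *)

(* Defs.v *)
From mathcomp Require Import all_boot all_order all_algebra.
From mathcomp Require Import finmap boolp.

Set Implicit Arguments.
Unset Strict Implicit.
Unset Printing Implicit Defensive.

Import GRing.Theory.

Local Open Scope ring_scope.

(* A formal power series is its sequence of coefficients. *)
Definition fps : Type := nat -> rat.

Definition fps_one : fps := fun n => (n == 0%N)%:R.

Definition fps_sub (F G : fps) : fps := fun n => F n - G n.

Definition fps_mul (F G : fps) : fps :=
  fun n => \sum_(i < n.+1) F i * G (n - i)%N.

Definition fps_exp (F : fps) (m : nat) : fps := iter m (fps_mul F) fps_one.

(* log F = \sum_(m >= 1) (-1)^(m-1) / m * (F - 1)^m.  When F has constant term
   1, (F - 1)^m has no terms of degree < m, so that only the summands with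
   m <= n contribute to the coefficient of x^n.  The value is meaningless when
   F 0 <> 1. *)
Definition fps_log (F : fps) : fps := fun n =>
  \sum_(1 <= m < n.+1)
    (-1) ^+ m.-1 / m%:R * fps_exp (fps_sub F fps_one) m n.

Local Close Scope ring_scope.

Section PlaneTrees.
Variables (k : nat) (V : {fset nat}).

(* The data (E, r, l) of a rooted plane k-ary tree with vertex set V.  The map
   l(v) : C(v) -> {1, .., k} is encoded as a function V -> option 'I_k with
   value None outside C(v); p : 'I_k stands for the slot p + 1. *)
Definition tree_data : finType :=
  ({set {set V}} * V * {ffun V -> {ffun V -> option 'I_k}})%type.

Implicit Types (t : tree_data) (u v : V).

Definition edges t : {set {set V}} := t.1.1.
Definition root_of t : V := t.1.2.
Definition slot t v u : option 'I_k := t.2 v u.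

Definition adj t : rel V := fun u v => [set u; v] \in edges t.

Definition graph_connected t : Prop := forall u v, connect (adj t) u v.

Definition graph_acyclic t : Prop :=
  forall c : seq V, 2 < size c -> ~ ucycle (adj t) c.

(* u is a child of v if v is the last vertex before u on the path from the
   root to u. *)
Definition is_child t v u : Prop :=
  exists s : seq V,
    [/\ path (adj t) (root_of t) (rcons s u),
        uniq (root_of t :: rcons s u) &
        last (root_of t) s = v].

Definition children t v : {set V} := [set u | `[< is_child t v u >]].

Record is_plane_tree t : Prop := IsPlaneTree {
  edges_pairs : forall e, e \in edges t -> #|e| = 2;
  tree_connected : graph_connected t;
  tree_acyclic : graph_acyclic t;
  children_bound : forall v, #|children t v| <= k;
  slot_domain : forall v u, (slot t v u != None) = (u \in children t v);
  slot_inj : forall v, {in children t v &, injective (slot t v)}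
}.

Inductive rightmost_branch t : V -> Prop :=
| rightmost_root : rightmost_branch t (root_of t)
| rightmost_step v u (p : 'I_k) :
    rightmost_branch t v -> slot t v u = Some p -> p.+1 = k ->
    rightmost_branch t u.

Definition root_minimal t : Prop :=
  forall v, rightmost_branch t v -> v != root_of t ->
    fsval (root_of t) < fsval v.

Definition plane_trees : {set tree_data} := [set t | `[< is_plane_tree t >]].

Definition root_minimal_trees : {set tree_data} :=
  [set t in plane_trees | `[< root_minimal t >]].

End PlaneTrees.

Definition interval1 (n : nat) : {fset nat} := [fset i in iota 1 n]%fset.

Definition Gk (k : nat) : fps := fun n =>
  (if n is 0 then 1 else 'C(k * n, n.-1)%:R / n%:R)%R.

Definition Gk_min (k : nat) : fps := fun n =>
  (if n is 0 then 0 else #|root_minimal_trees k (interval1 n)|%:R / n`!%:R)%R.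

(* Main.v *)
(** Cutting a plane k-ary tree along its rightmost branch leaves, for a branch
    with m vertices, a forest in the (k-1)m remaining slots of the branch.  Among
    the orderings of the labels of the branch exactly one in m starts with the
    minimum, hence [x^n] of the generating function of root-minimal trees is
    \sum_m 1/m [x^(n-m)] G^((k-1)m).  On the other side G - 1 = x G^k, so that
    [x^n] log G = \sum_m (-1)^(m-1)/m [x^(n-m)] G^(km).  The coefficients of the
    powers of G have the closed form [x^n] G^j = j/(j+kn) 'C(j+kn, n), and both
    sums evaluate to 'C(kn-1, n-1)/n.

    Labelled forests are counted by filling a list of open slots one at a time:
    the first slot either stays vacant, or receives a label u and is replaced in
    the list by the k slots of u. *)

Require Import Defs.
From mathcomp Require Import all_boot all_order all_algebra.
From mathcomp Require Import finmap boolp.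
From mathcomp Require Import zify ring.

Set Implicit Arguments.
Unset Strict Implicit.
Unset Printing Implicit Defensive.

Import GRing.Theory Num.Theory.

(** * Unlabelled forest numbers: closed form and convolution *)

(* The number of j-tuples of possibly empty plane k-ary trees with n unlabelled
   vertices in total, that is, [x^n] G^j.  In the recursion i is the number of
   trees that follow the first nonempty one, whose root has k subtrees. *)
Fixpoint forests (k n j : nat) : nat :=
  if n is n'.+1 then \sum_(i < j) forests k n' (i + k) else 1.

(** Either the first tree is empty, or the [k] subtrees of its root join the other [j] trees. *)
Lemma forestsS k n j :
  forests k n.+1 j.+1 = forests k n.+1 j + forests k n (j + k).
Proof. by rewrite /= big_ord_recr. Qed.

(** The ballot-type formula for $[x^n]G^j$, cleared of denominators to stay in [nat]. Double
    induction along [forestsS]. *)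
Lemma forests_closed k n j : 0 < k ->
  (j + k * n) * forests k n j = j * 'C(j + k * n, n).
Proof.
move=> k0; elim: n j => [|n IHn] j; first by rewrite muln0 addn0 bin0.
elim: j => [|j IHj]; first by rewrite /= big_ord0 muln0.
(* Shifting [j] by [k] compensates for the smaller [n]: both induction hypotheses involve the same
   [N]. *)
have := IHn (j + k); rewrite -addnA -mulnS => {}IHn.
rewrite forestsS addSn.
set N := j + k * n.+1 in IHj IHn *.
have leN : n <= N by rewrite /N; nia.
have N0 : 0 < N by rewrite /N; nia.
have E1 := mul_bin_left N n; have E2 := mul_bin_diag N.+1 n.
rewrite /= in E2.
(* The factor [N] makes the induction hypotheses applicable; [n.+1] lets the absorption identities
   reduce everything to multiples of ['C(N, n)]. *)
have /eqP : N * n.+1 * (N.+1 * (forests k n.+1 j + forests k n (j + k))) =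
            N * n.+1 * (j.+1 * 'C(N.+1, n.+1)).
  have -> : N * n.+1 * (N.+1 * (forests k n.+1 j + forests k n (j + k))) =
    n.+1 * N.+1 * (N * forests k n.+1 j + N * forests k n (j + k)) by ring.
  rewrite IHj IHn.
  have -> : N * n.+1 * (j.+1 * 'C(N.+1, n.+1)) =
    N * j.+1 * (n.+1 * 'C(N.+1, n.+1)) by ring.
  rewrite -E2.
  have -> : n.+1 * N.+1 * (j * 'C(N, n.+1) + (j + k) * 'C(N, n)) =
    N.+1 * (j * (n.+1 * 'C(N, n.+1)) + n.+1 * (j + k) * 'C(N, n)) by ring.
  rewrite E1.
  have -> : N.+1 * (j * ((N - n) * 'C(N, n)) + n.+1 * (j + k) * 'C(N, n)) =
    N.+1 * 'C(N, n) * (j * (N - n) + n.+1 * (j + k)) by ring.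
  have -> : j * (N - n) + n.+1 * (j + k) = N * j.+1.
    have : N = j + k * n.+1 by [].
    nia.
  by ring.
by rewrite eqn_pmul2l ?muln_gt0 ?N0 // => /eqP.
Qed.

(** This is $G^a G^b = G^{a+b}$; the recursion [forestsS] is applied to the first factor. *)
Lemma forests_conv k n a b : 0 < k ->
  \sum_(i < n.+1) forests k i a * forests k (n - i) b = forests k n (a + b).
Proof.
move=> k0; elim: n a b => [|n IHn] a b; first by rewrite big_ord1.
elim: a => [|a IHa].
  rewrite big_ord_recl subn0 mul1n big1 ?addn0 ?add0n // => i _.
  by rewrite /= big_ord0.
rewrite addSn forestsS -IHa addnAC -IHn.
rewrite big_ord_recl [in RHS]big_ord_recl -!addnA; congr (_ + _).
rewrite -big_split /=; apply: eq_bigr => i _.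
by rewrite /bump /= add1n subSS -mulnDl big_ord_recr.
Qed.

(** * Counting forests by filling slots *)

Section ChildMaps.
Variables (T : finType) (K : nat).
Notation slotT := (T * 'I_K.+1)%type.
Notation cmap := {ffun slotT -> option T}.
Implicit Types (g : cmap) (s : slotT) (L : seq slotT) (U W : {set T}) (u v : T).

(* g sends a slot (v, p) to the vertex that occupies it.  In [is_forest L U g]
   the vertices of g are the elements of U, and the roots of g occupy slots of L.
   Connectedness and acyclicity are both expressed by [forest_reach]: every
   nonempty set of vertices is entered from outside. *)
Record is_forest L U g : Prop := IsForest {
  forest_supp : forall s u, g s = Some u -> (s \in L) || (s.1 \in U);
  forest_val : forall s u, g s = Some u -> u \in U;
  forest_inj : forall s s' u, g s = Some u -> g s' = Some u -> s = s';
  forest_reach : forall W, W \subset U -> W != set0 ->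
    exists s u, [/\ s.1 \notin W, g s = Some u & u \in W] }.

(* The rightmost slot comes first: [card_right_branch] fills it first. *)
Definition slots u : seq slotT :=
  (u, ord_max) :: [seq (u, p) | p <- enum 'I_K.+1 & p != ord_max].

Lemma mem_slots u s : (s \in slots u) = (s.1 == u).
Proof.
case: s => v p; rewrite inE xpair_eqE /=; apply/idP/idP.
  by case/orP=> [/andP[]//|/mapP[q _ [-> _]]].
move=> /eqP->; rewrite eqxx /=; case: eqVneq => //= np.
by apply/mapP; exists p => //; rewrite mem_filter np mem_enum.
Qed.

Lemma slots_uniq u : uniq (slots u).
Proof.
rewrite /= map_inj_uniq => [|p q []//]; rewrite filter_uniq ?enum_uniq // andbT.
by apply/mapP=> -[p]; rewrite mem_filter => /andP[np _] [E]; rewrite -E eqxx in np.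
Qed.

Lemma size_slots u : size (slots u) = K.+1.
Proof.
rewrite -(card_uniqP (slots_uniq u)).
transitivity #|setX [set u] [set: 'I_K.+1]|.
  by apply: eq_card => s; rewrite mem_slots !inE andbT.
by rewrite cardsX cards1 cardsT card_ord mul1n.
Qed.

#[local] Arguments slots : simpl never.

Definition cut g s : cmap := [ffun x => if x == s then None else g x].
Definition plug g s u : cmap := [ffun x => if x == s then Some u else g x].

(** First case of slot filling. As [s] is neither in [L] nor at a vertex of [U], a forest over [L]
    leaves it vacant. *)
Lemma forest_vacant s L U g : s.1 \notin U -> s \notin L ->
  is_forest (s :: L) U g /\ g s = None <-> is_forest L U g.
Proof.
move=> sU sL; split=> [[[h1 h2 h3 h4] gs]|[h1 h2 h3 h4]].
  split=> // x u gx; have := h1 _ _ gx; rewrite inE -orbA.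
  by case: eqVneq gx => [->|//]; rewrite gs.
split; last by case E: (g s) => [u|//]; have := h1 _ _ E; rewrite (negPf sU) (negPf sL).
by split=> // x u gx; rewrite inE -orbA (h1 _ _ gx) orbT.
Qed.

(** Second case of slot filling: once placed in [s], the vertex [u] counts as outside, and its own
    slots become open. *)
Lemma forest_occupied s L U u g : s.1 \notin U -> s \notin L -> u \in U ->
  is_forest (s :: L) U (plug g s u) /\ g s = None <->
  is_forest (slots u ++ L) (U :\ u) g.
Proof.
move=> sU sL uU.
have su : s.1 != u by apply: contraNneq sU => ->.
have ps : plug g s u s = Some u by rewrite ffunE eqxx.
have pN x : x != s -> plug g s u x = g x by rewrite ffunE => /negPf->.
split=> [[[h1 h2 h3 h4] gs]|[h1 h2 h3 h4]].
  have ns x w : g x = Some w -> x != s.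
    by move=> gx; apply/eqP => xs; rewrite xs gs in gx.
  split.
  - move=> x w gx; have xs := ns _ _ gx; rewrite -(pN _ xs) in gx.
    have := h1 _ _ gx; rewrite in_cons (negPf xs) mem_cat mem_slots in_setD1.
    by case: (x.1 =P u).
  - move=> x w gx; have xs := ns _ _ gx; rewrite -(pN _ xs) in gx.
    rewrite !inE (h2 _ _ gx) andbT; apply: contra_neq xs => wu.
    by rewrite wu in gx; apply: h3 gx ps.
  - by move=> x y w gx gy; apply: (h3 _ _ w); rewrite pN //; apply: ns; eassumption.
  - move=> W /subsetD1P[WU uW] W0; have [x [w [xW gx wW]]] := h4 _ WU W0.
    exists x, w; split=> //; rewrite -pN //; apply: contraNneq uW => xs.
    by move: gx; rewrite xs ps => -[->].
have gs : g s = None.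
  case E: (g s) => [w|//]; have := h1 _ _ E.
  by rewrite mem_cat mem_slots in_setD1 (negPf su) (negPf sU) (negPf sL).
have uN x : g x <> Some u by move=> /h2; rewrite !inE eqxx.
split=> //; split.
- move=> x w; rewrite ffunE inE; case: eqVneq => //= _ /h1.
  rewrite mem_cat mem_slots in_setD1 => /orP[/orP[/eqP->|->]|/andP[_ ->]] //.
    by rewrite uU orbT.
  by rewrite orbT.
- move=> x w; rewrite ffunE; case: eqVneq => [_ [<-]//|_ /h2].
  by rewrite !inE => /andP[].
- move=> x y w; rewrite !ffunE; case: eqVneq => [->|_]; case: eqVneq => // _.
  + by move=> [<-] /uN.
  + by move=> + [uw]; rewrite -uw => /uN.
  + exact: h3.
(* A set containing [u] is entered through [s], which lies outside [U]; any other set is entered as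
   in [g]. *)
- move=> W WU W0; have [uW|uW] := boolP (u \in W).
    by exists s, u; split=> //; apply: contra sU; apply: (subsetP WU).
  have WU' : W \subset U :\ u by apply/subsetD1P.
  have [x [w [xW gx wW]]] := h4 _ WU' W0; exists x, w; split=> //.
  by rewrite pN //; apply/eqP => xs; rewrite xs gs in gx.
Qed.

Lemma plug_cut g s u : g s = Some u -> plug (cut g s) s u = g.
Proof. by move=> gs; apply/ffunP=> x; rewrite !ffunE; case: eqVneq => [->|]. Qed.

Lemma cut_plug g s u : g s = None -> cut (plug g s u) s = g.
Proof. by move=> gs; apply/ffunP=> x; rewrite !ffunE; case: eqVneq => [->|]. Qed.

(** The condition [Q] lets one recursion serve both the count of all forests and the count
    restricted along the right branch. *)
Definition forest_set L U (Q : pred cmap) : {set cmap} :=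
  [set g | `[< is_forest L U g >] && Q g].

Lemma card_forest_step s L U Q : s.1 \notin U -> s \notin L ->
  #|forest_set (s :: L) U Q| = #|forest_set L U Q| +
    \sum_(u in U) #|forest_set (slots u ++ L) (U :\ u) (fun g : cmap => Q (plug g s u))|.
Proof.
move=> sU sL.
rewrite -(cardsID [set g : cmap | g s == None]); congr (_ + _).
  apply: eq_card => g; rewrite !inE.
  apply/andP/andP=> [[/andP[/asboolP F ->] /eqP gs]|[/asboolP F ->]].
    by split=> //; apply/asboolP/(forest_vacant g sU sL).
  have [F' gs] := (forest_vacant g sU sL).2 F; split; last exact/eqP.
  by rewrite andbT; apply/asboolP.
rewrite -sum1_card.
(* Classes by the occupant of [s]; the default [s.1] never occurs, since [s] is occupied here. *)
rewrite (partition_big (fun g : cmap => odflt s.1 (g s)) (mem U)) /=; last first.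
  move=> g; rewrite !inE => /andP[gs /andP[/asboolP[_ h _ _] _]].
  by case E: (g s) gs => [u|//] _; apply: h E.
apply: eq_bigr => u uU; rewrite sum1_card.
set B := forest_set (slots u ++ L) _ _.
have gsB g : g \in B -> g s = None.
  by rewrite inE => /andP[/asboolP F _]; case: ((forest_occupied g sU sL uU).2 F).
rewrite -(card_in_imset (f := fun g : cmap => plug g s u) (D := mem B)); last first.
  by move=> g h /gsB gs /gsB hs /(congr1 (cut^~ s)); rewrite !cut_plug.
apply: eq_card => g; rewrite [LHS]inE /= !inE; apply/idP/imsetP.
  case/andP=> /andP[gs /andP[/asboolP F q]] /eqP gu.
  case E: (g s) gs gu => [w|//] _ /= wu; rewrite {w}wu in E.
  exists (cut g s); last by rewrite /= plug_cut.
  rewrite inE /= plug_cut // q andbT; apply/asboolP/(forest_occupied _ sU sL uU).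
  by rewrite plug_cut //; split=> //; rewrite ffunE eqxx.
case=> h; rewrite inE => /andP[/asboolP F q] ->; rewrite q ffunE eqxx /= eqxx !andbT.
by apply/asboolP; case: ((forest_occupied h sU sL uU).2 F).
Qed.

(** The invariant of slot filling: distinct slots, all at vertices that are already placed. *)
Definition open_slots L U : bool := uniq L && all (fun s => s.1 \notin U) L.

Lemma open_slots_step L U u : open_slots L U -> u \in U ->
  open_slots (slots u ++ L) (U :\ u).
Proof.
move=> /andP[uL /allP aL] uU; rewrite /open_slots cat_uniq slots_uniq uL all_cat.
rewrite andTb andbT; apply/and3P; split.
- by apply/hasPn=> s /aL; rewrite mem_slots; apply: contra => /eqP->.
- by apply/allP=> s; rewrite mem_slots !inE => /eqP->; rewrite eqxx.
- by apply/allP=> s /aL sU; rewrite !inE (negPf sU) andbF.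
Qed.

(** The recursion of [card_forest_step] is that of [forestsS], with an extra factor [#|U|] for the
    label of each new vertex; these factors make up [n!]. *)
Lemma card_forests n L U : #|U| = n -> open_slots L U ->
  #|forest_set L U predT| = n`! * forests K.+1 n (size L).
Proof.
elim: n L U => [|n IHn] L U.
  move=> /cards0_eq->; elim: L => [|s L IHL] /andP[uL aL].
    transitivity #|[set [ffun=> None] : cmap]|; last by rewrite cards1.
    apply: eq_card => g.
    rewrite !inE andbT; apply/asboolP/eqP => [[h _ _ _]|->].
      apply/ffunP=> x; rewrite ffunE; case E: (g x) => [w|//].
      by have := h _ _ E; rewrite in_nil in_set0.
    split=> [x w|x w|x y w|W]; rewrite ?ffunE //.
    by rewrite subset0 => ->.
  case/andP: uL => sL uL; case/andP: aL => sU aL.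
  have oL : open_slots L set0 by apply/andP.
  by rewrite card_forest_step // big_set0 addn0 IHL.
move=> cU; elim: L => [|s L IHL] /andP[uL aL].
  rewrite /= big_ord0 muln0; apply: eq_card0 => g; rewrite !inE andbT.
  (* Without open slots, nothing outside [U] can enter [U]. *)
  apply/asboolP=> -[h1 _ _ h4]; have [||s [u [sU gs _]]] := h4 U => //.
    by rewrite -card_gt0 cU.
  by have := h1 _ _ gs; rewrite in_nil (negPf sU).
case/andP: uL => sL uL; case/andP: aL => sU aL.
have oL : open_slots L U by apply/andP.
rewrite card_forest_step // IHL // [size (_ :: _)]/= forestsS mulnDr; congr (_ + _).
rewrite (eq_bigr (fun=> n`! * forests K.+1 n (size L + K.+1))) => [|u uU].
  by rewrite sum_nat_const cU mulnA.
rewrite IHn ?open_slots_step //.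
  by rewrite size_cat size_slots addnC.
by have := cardsD1 u U; rewrite uU cU => -[].
Qed.

(** * Forests constrained along the right branch *)

Definition right_rel g : rel T := fun v u => g (v, ord_max) == Some u.

(** Root-minimality is the case where [P] requires a label larger than that of [v]; hence [v] itself
    is exempt. *)
Definition right_branch_in (P : pred T) v g : bool :=
  [forall u, connect (right_rel g) v u ==> (u != v) ==> P u].

Lemma right_branch_vacant P v g : g (v, ord_max) = None -> right_branch_in P v g.
Proof.
move=> gv; apply/forallP=> u; apply/implyP=> /connectP[[|x p] /= pth ->].
  by rewrite eqxx.
by move: pth; rewrite /right_rel gv.
Qed.

Lemma right_branch_plug P v L U u g : v \notin U -> (v, ord_max) \notin L ->
  u \in U -> is_forest (slots u ++ L) (U :\ u) g ->
  right_branch_in P v (plug g (v, ord_max) u) = P u && right_branch_in P u g.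
Proof.
move=> vU vL uU F; set h := plug _ _ _.
have [F' gv] := (@forest_occupied (v, ord_max) L U u g vU vL uU).2 F.
have hv w : right_rel h v w = (u == w) by rewrite /right_rel ffunE eqxx.
have hN x w : x != v -> right_rel h x w = right_rel g x w.
  by move=> xv; rewrite /right_rel ffunE xpair_eqE (negPf xv).
(* Right branches from [u] stay inside [U], hence never meet [v], the only vertex where the two
   relations differ. *)
have pathU p : path (right_rel h) u p -> (last u p \in U) /\ path (right_rel g) u p.
  elim/last_ind: p => [//|p x IHp]; rewrite !rcons_path last_rcons => /andP[/IHp[lU pg] hx].
  rewrite pg -hN; last by apply: contraNneq vU => <-.
  by split; [apply: (forest_val F') (eqP hx)|].
have pathG p : path (right_rel g) u p -> (last u p \in U) /\ path (right_rel h) u p.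
  elim/last_ind: p => [//|p x IHp]; rewrite !rcons_path last_rcons => /andP[/IHp[lU pg] hx].
  rewrite pg hN; last by apply: contraNneq vU => <-.
  by split; [have := forest_val F (eqP hx); rewrite inE => /andP[]|].
apply/forallP/andP=> [A|[Pu /forallP A] w].
  split.
    have := A u; rewrite connect1 ?hv //=.
    by have -> : u != v by apply: contraNneq vU => <-.
  apply/forallP=> w; apply/implyP=> /connectP[p /pathG[lU pg] Ew].
  apply/implyP=> _; have := A w.
  have -> : connect (right_rel h) v w.
    by apply/connectP; exists (u :: p); rewrite //= hv eqxx.
  by have -> : w != v by apply: contraNneq vU => <-; rewrite Ew.
apply/implyP=> /connectP[[|x p] /= pth Ew].
  by rewrite Ew eqxx.
move: pth; rewrite hv => /andP[/eqP ux]; rewrite -ux in Ew * => /pathU[lU pg].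
apply/implyP=> _; have := A w.
have -> : connect (right_rel g) u w by apply/connectP; exists p.
by case: eqVneq => [->|].
Qed.

(* i counts the vertices of the right branch below v. *)
Lemma card_right_branch P n v L U : #|U| = n ->
  open_slots ((v, ord_max) :: L) U ->
  #|forest_set ((v, ord_max) :: L) U (right_branch_in P v)| =
  \sum_(i < n.+1) #|[set u in U | P u]| ^_ i *
     ((n - i)`! * forests K.+1 (n - i) (size L + i * K)).
Proof.
elim: n v L U => [|n IHn] v L U cU.
all: move=> /andP[/andP[vL uL] /andP[vU aL]].
all: have oL : open_slots L U by [apply/andP].
all: rewrite card_forest_step // big_ord_recl ffactn0 mul1n subn0 addn0.
all: rewrite -(card_forests cU oL); congr (_ + _).
all: try by (apply: eq_card => g; rewrite !inE andbT; apply: andb_idr => /asboolP F;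
    apply: right_branch_vacant; case: (forest_vacant g vU vL) => _ /(_ F)[]).
  by rewrite big_ord0 (cards0_eq cU) big_set0.
set a := #|_|.
(* The vacant case gave the term [i = 0]. Otherwise the branch continues at some [u] satisfying [P]:
   one candidate fewer remains, and the [K] other slots of [u] join [L]. *)
transitivity (\sum_(u in [set u in U | P u]) \sum_(i < n.+1) a.-1 ^_ i *
     ((n - i)`! * forests K.+1 (n - i) (size L + i.+1 * K))).
  rewrite [RHS](eq_bigl (fun u => (u \in U) && P u)) => [|u]; last by rewrite inE.
  rewrite big_mkcondr; apply: eq_bigr => u uU.
  case: ifP => Pu; last first.
    apply: eq_card0 => g; rewrite !inE; apply/negP=> /andP[/asboolP F].
    by rewrite (right_branch_plug P vU vL uU F) Pu.
  transitivity #|forest_set (slots u ++ L) (U :\ u) (right_branch_in P u)|.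
    apply: eq_card => g; rewrite !inE; apply: andb_id2l => /asboolP F.
    by rewrite (right_branch_plug P vU vL uU F) Pu.
  rewrite IHn; last 2 first.
  - by have := cardsD1 u U; rewrite uU cU => -[].
  - by have := open_slots_step oL uU.
  have -> : #|[set w in U :\ u | P w]| = a.-1.
    rewrite /a (cardsD1 u [set w in U | P w]) inE uU Pu /=.
    by apply: eq_card => w; rewrite !inE andbA.
  apply: eq_bigr => i _; rewrite size_cat.
  have /eq_add_S -> : (size [seq (u, p) | p <- enum 'I_K.+1 & p != ord_max]).+1 = K.+1.
    exact: size_slots u.
  by rewrite mulSn addnCA addnA.
rewrite sum_nat_const -/a big_distrr; apply: eq_bigr => i _ /=.
by rewrite /bump /= add1n subSS mulnA ffactnS.
Qed.

End ChildMaps.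
(** * Arborescences and rooted trees *)

Section Arborescence.
Variables (T : finType).
Implicit Types (e : rel T) (r u v x y : T) (W : {set T}).

(** Trees oriented away from [r]. As in [is_forest], [arb_enter] expresses reachability and the
    absence of directed cycles together. *)
Record arborescence e r : Prop := Arborescence {
  arb_root : forall v, ~~ e v r;
  arb_parent : forall v v' u, e v u -> e v' u -> v = v';
  arb_enter : forall W, r \notin W -> W != set0 ->
    exists v u, [/\ v \notin W, e v u & u \in W] }.

Definition symr e : rel T := [rel x y | e x y || e y x].

(** * From arborescences to connected acyclic graphs *)

Section FromArborescence.
Variables (e : rel T) (r : T).
Hypothesis arb : arborescence e r.

(** The set of counterexamples would be entered by an edge from a vertex satisfying [P]. *)
Lemma arb_ind (P : T -> Prop) :
  P r -> (forall v u, P v -> e v u -> P u) -> forall u, P u.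
Proof.
move=> Pr Pe u; apply: contrapT => nPu.
have [||v [w [vW evw wW]]] := arb_enter arb (W := [set u | `[< ~ P u >]]).
- by rewrite inE; apply/asboolPn; apply.
- by apply/set0Pn; exists u; rewrite inE; apply/asboolP.
move: vW wW; rewrite !inE => /asboolPn/contrapT Pv /asboolP; apply.
exact: Pe evw.
Qed.

Lemma arb_depth : exists d : T -> nat, forall v u, e v u -> d u = (d v).+1.
Proof.
(* The default makes the root its own parent; the depth is the least number of parent steps that
   reach [r]. *)
pose par u := odflt u [pick v | e v u].
have parE v u : e v u -> par u = v.
  move=> ev; rewrite /par; case: pickP => [w ew|/(_ v)]; last by rewrite ev.
  by rewrite /=; exact: (arb_parent arb ew ev).
have ex u : exists i, iter i par u == r.
  elim/arb_ind: u => [|v u [i /eqP iv] evu]; first by exists 0.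
  by exists i.+1; rewrite iterSr (parE _ _ evu) iv.
exists (fun u => ex_minn (ex u)) => v u evu.
case: ex_minnP => -[/eqP /= ur|i]; first by rewrite ur (negPf (arb_root arb v)) in evu.
rewrite iterSr (parE _ _ evu) => iv min_i.
case: ex_minnP => j jv /(_ _ iv) le_ji; apply/eqP; rewrite eqSS eqn_leq le_ji andbT.
by rewrite -ltnS min_i // iterSr (parE _ _ evu).
Qed.

Lemma arb_irr x : ~~ e x x.
Proof.
by have [d dE] := arb_depth; apply/negP=> /dE/eqP; rewrite -[d x]addn0 -addnS eqn_add2l.
Qed.

(** A simple path from the root never goes up: an upward step would lead back to the preceding
    vertex. *)
Lemma arb_simple_path s u :
  path (symr e) r (rcons s u) -> uniq (r :: rcons s u) -> e (last r s) u.
Proof.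
elim/last_ind: s u => [|s x IHs] u.
  by rewrite /= andbT => /orP[//|]; rewrite (negPf (arb_root arb u)).
rewrite rcons_path => /andP[ps]; rewrite last_rcons -rcons_cons rcons_uniq.
rewrite -rcons_cons => /orP[//|eux] /andP[us uniqs].
have ex := IHs _ ps uniqs; move: us.
by rewrite (arb_parent arb eux ex) -cats1 mem_cat mem_last.
Qed.

Lemma arb_path u : exists s,
  [/\ path (symr e) r s, uniq (r :: s) & last r s = u].
Proof.
have [d dE] := arb_depth.
(* The depth bound is added to the induction so that a child appended to the path is new to it. *)
suff [s [ps us rs _ ls]] : exists s, [/\ path (symr e) r s, uniq s, r \notin s,
    {in r :: s, forall x, d x <= d u} & last r s = u].
  by exists s; split; rewrite /= ?rs.
elim/arb_ind: u => [|v u [s [ps us rs ds ls]] evu].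
  by exists [::]; split=> // x; rewrite inE => /eqP->.
have uN : u \notin r :: s.
  by apply/negP=> /ds; rewrite (dE _ _ evu) ltnn.
exists (rcons s u); split.
- by rewrite rcons_path ps ls; apply/orP; left.
- by rewrite rcons_uniq us andbT; apply: contra uN; rewrite inE => ->; rewrite orbT.
- rewrite mem_rcons inE negb_or rs andbT; apply: contraNneq uN => ->.
  exact: mem_head.
- move=> x; rewrite -rcons_cons mem_rcons inE => /orP[/eqP->//|/ds dx].
  by rewrite (dE _ _ evu); apply: leqW.
- by rewrite last_rcons.
Qed.

(* Both neighbours of the deepest vertex of a cycle would be its parent. *)
Lemma arb_acyclic (c : seq T) : 2 < size c -> ~ ucycle (symr e) c.
Proof.
move=> c2 /andP[cyc uc]; have [d dE] := arb_depth.
have [x0 x0c] : exists x, x \in c by case: c c2 {cyc uc} => // x c; exists x; rewrite mem_head.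
case: (@arg_maxnP _ x0 (mem c) d x0c) => x xc dmax.
have [i p cE] := rot_to xc.
have nparent y : y \in c -> symr e x y -> e y x.
  by move=> yc /orP[/dE dy|//]; have := dmax _ yc; rewrite /= dy ltnn.
have memp y : y \in x :: p -> y \in c by rewrite -cE mem_rot.
move: cyc uc c2; rewrite -(rot_cycle i) -(rot_uniq i) -(size_rot i) cE.
case: p memp {cE} => [//|y p] memp; case/lastP: p memp => [//|p z] memp /=.
rewrite rcons_path last_rcons => /and3P[exy _ ezx].
have eyx : e y x by apply: nparent => //; apply: memp; rewrite !inE eqxx orbT.
have {}ezx : e z x.
  apply: nparent; last by rewrite /symr /= orbC.
  by apply: memp; rewrite !inE mem_rcons mem_head !orbT.
by rewrite (arb_parent arb eyx ezx) mem_rcons mem_head andbF.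
Qed.

End FromArborescence.

(** * From connected acyclic graphs to arborescences *)

Section FromGraph.
Variables (a : rel T) (r : T).
Hypotheses (a_sym : symmetric a) (a_irr : irreflexive a).
Hypothesis a_conn : forall u v, connect a u v.
Hypothesis a_acyc : forall c : seq T, 2 < size c -> ~ ucycle a c.

Definition child_of v u : Prop := exists s : seq T,
  [/\ path a r (rcons s u), uniq (r :: rcons s u) & last r s = v].

(** If the ends differed, a simple path between these two neighbours of [x] would close to a cycle
    through [x]. *)
Lemma acyclic_bypass x y p :
  path a y p -> x \notin y :: p -> a x y -> a (last y p) x -> last y p = y.
Proof.
move=> /shortenP[q pq uq qp] xp axy alx; case/lastP: q pq uq qp alx => [//|q z].
rewrite last_rcons => pq uq qp azx.
case: (a_acyc (c := x :: y :: rcons q z)); first by rewrite /= size_rcons.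
rewrite /ucycle /= axy rcons_path pq last_rcons azx /=.
move: uq => /= ->; rewrite andbT; apply: contra xp.
by rewrite !inE => /orP[->//|/qp->]; rewrite orbT.
Qed.

Lemma child_adj v u : child_of v u -> a v u.
Proof. by case=> s [ps _ <-]; move: ps; rewrite rcons_path => /andP[]. Qed.

Lemma child_root v : ~ child_of v r.
Proof. by case=> s [_ + _]; rewrite /= mem_rcons mem_head. Qed.

(* Two parents of u would be joined by a path avoiding u, closing a cycle at u. *)
Lemma child_parent v v' u : child_of v u -> child_of v' u -> v = v'.
Proof.
pose b := [rel x y | [&& a x y, x != u & y != u]].
have b_conn w : child_of w u -> connect b r w.
  case=> s [+ + <-]; rewrite rcons_path -rcons_cons rcons_uniq.
  move=> /andP[ps _] /andP[us _]; apply/connectP; exists s => //.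
  apply: (sub_in_path (P := predC1 u)) ps; last first.
    by apply/allP=> x xs; apply: contraNneq us => <-.
  by move=> x y /= xu yu axy; apply/and3P.
have b_sym : symmetric b by move=> x y /=; rewrite a_sym; congr (_ && _); rewrite andbC.
move=> vu v'u; have: connect b v v'.
  apply: connect_trans (b_conn _ v'u).
  by rewrite (sym_connect_sym b_sym) b_conn.
case/connectP=> p pb v'E; rewrite v'E; apply/esym/(@acyclic_bypass u).
- by apply: sub_path pb => x y /and3P[].
- have vNu : v != u by apply: contraTneq (child_adj vu) => ->; rewrite a_irr.
  elim: p v vNu pb {vu v'E} => [|y p IHp] v vNu /=; first by rewrite inE eq_sym.
  by case/andP=> /and3P[_ _ yNu] /(IHp _ yNu) yp; rewrite inE negb_or eq_sym vNu.
- by rewrite a_sym child_adj.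
- by rewrite -v'E child_adj.
Qed.

(** On a simple path from [r] to a vertex of [W], each vertex is a child of its predecessor, and
    some step enters [W]. *)
Lemma child_enter W : r \notin W -> W != set0 ->
  exists v u, [/\ v \notin W, child_of v u & u \in W].
Proof.
move=> rW /set0Pn[w wW]; case/connectP: (a_conn r w) => p0 /shortenP[p pp up _] wE.
rewrite wE in wW; elim/last_ind: p pp up wW {wE} => [|p x IHp] pp up.
  by rewrite /= (negPf rW).
rewrite last_rcons => xW; have [lW|lW] := boolP (last r p \in W).
  apply: IHp => //; first by move: pp; rewrite rcons_path => /andP[].
  by move: up; rewrite -rcons_cons rcons_uniq => /andP[].
by exists (last r p), x; split=> //; exists p.
Qed.

Lemma adj_child x y : a x y -> child_of x y \/ child_of y x.
Proof.
move=> axy; case/connectP: (a_conn r x) => p0 /shortenP[p pp up _] xE.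
have [yp|yp] := boolP (y \in r :: p); last first.
  left; exists p; split=> //; first by rewrite rcons_path pp -xE.
  by rewrite -rcons_cons rcons_uniq yp.
right; case/splitPl: yp pp up xE => p1 p2 p1E.
case/lastP: p2 => [|p2 z]; first by rewrite cats0 p1E => _ _ yx; rewrite yx a_irr in axy.
rewrite -rcons_cat last_rcons => pp up xz; rewrite -{z}xz in pp up *.
exists (p1 ++ p2); split=> //; rewrite last_cat p1E.
move: pp; rewrite rcons_cat cat_path p1E rcons_path => /and3P[_ p2P alx].
(* If [y] precedes [x] on the simple path, the segment from [y] to the predecessor of [x] avoids
   [x]; hence [y] is that predecessor. *)
apply: (@acyclic_bypass x) => //.
move: up; rewrite -rcons_cons rcons_uniq -cat_cons mem_cat negb_or => /andP[/andP[xp1 xp2] _].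
rewrite inE negb_or xp2 andbT; apply: contraNneq xp1 => ->.
by rewrite -p1E mem_last.
Qed.

End FromGraph.
End Arborescence.
(** * Plane trees as child maps *)

Section TreeEncoding.
Variables (K : nat) (V : {fset nat}).
Notation cmap := {ffun V * 'I_K.+1 -> option V}.
Notation data := (tree_data K.+1 V).
Implicit Types (t : data) (g : cmap) (r u v : V) (p : 'I_K.+1).

Definition child_rel g : rel V := fun v u => [exists p, g (v, p) == Some u].

Lemma child_relP g v u : reflect (exists p, g (v, p) = Some u) (child_rel g v u).
Proof. by apply: (iffP existsP) => -[p] => [/eqP|] gu; exists p; rewrite ?gu. Qed.

(** A tree sends children to slots, a child map sends slots to occupants; these are mutually inverse
    views. *)
Definition same_slots t g : Prop :=
  forall v u p, slot t v u = Some p <-> g (v, p) = Some u.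

Definition same_edges t g : Prop :=
  edges t = [set e | [exists v, exists u, child_rel g v u && (e == [set v; u])]].

Definition data_of r g : data :=
  ([set e : {set V} | [exists v, exists u, child_rel g v u && (e == [set v; u])]], r,
   [ffun v => [ffun u => [pick p | g (v, p) == Some u]]]).

Lemma data_of_slots r g :
  (forall s s' u, g s = Some u -> g s' = Some u -> s = s') ->
  same_slots (data_of r g) g.
Proof.
move=> ginj v u p; rewrite /slot /= !ffunE; case: pickP => [q /eqP gq|gN].
  split=> [[<-//]|gp]; congr Some.
  by have [] := ginj _ _ _ gq gp.
by split=> // gp; have := gN p; rewrite gp eqxx.
Qed.

Lemma same_edges_adj t g : same_edges t g -> adj t =2 symr (child_rel g).
Proof.
move=> tE v u; rewrite /adj tE inE; apply/existsP/orP.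
  case=> x /existsP[y /andP[exy /eqP/setP E]].
  have := E v; have := E u; have := E x; have := E y.
  rewrite !inE !eqxx /= !orbT.
  move=> /orP[]/eqP yE /orP[]/eqP xE /esym/orP[]/eqP uE /esym/orP[]/eqP vE;
    subst; by [left|right].
case=> e; first by exists v; apply/existsP; exists u; rewrite e eqxx.
by exists u; apply/existsP; exists v; rewrite e setUC eqxx.
Qed.

(** Every slot belongs to [r] or to a vertex of [[set~ r]], which gives the support condition.
    Injectivity says more than uniqueness of parents: a child occupies only one slot. *)
Lemma forest_arborescence r g :
  is_forest (slots K r) [set~ r] g <->
  arborescence (child_rel g) r /\
  (forall s s' u, g s = Some u -> g s' = Some u -> s = s').
Proof.
split=> [[h1 h2 h3 h4]|[[h1 h2 h3] h4]].
  split=> //; split.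
  - by move=> v; apply/child_relP=> -[p /h2]; rewrite !inE eqxx.
  - by move=> v v' u /child_relP[p gp] /child_relP[p' gp']; case: (h3 _ _ _ gp gp').
  - move=> W rW W0; have [||[v p] [u [vW gv uW]]] := h4 W => //.
      by apply/subsetP=> x xW; rewrite !inE; apply: contraNneq rW => <-.
    by exists v, u; split=> //; apply/child_relP; exists p.
split=> //.
- by move=> [v p] u _; rewrite mem_slots !inE orbN.
- move=> [v p] u gu; rewrite !inE; apply/eqP=> ur; have := h1 v.
  by case/negP; apply/child_relP; exists p; rewrite gu ur.
- move=> W Wr W0; have rW : r \notin W.
    by apply/negP=> /(subsetP Wr); rewrite !inE eqxx.
  have [v [u [vW /child_relP[p gp] uW]]] := h3 W rW W0.
  by exists (v, p), u.
Qed.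

Lemma adj_sym t : symmetric (adj t).
Proof. by move=> u v; rewrite /adj setUC. Qed.

Lemma plane_tree_of_arborescence t g :
  same_slots t g -> same_edges t g ->
  arborescence (child_rel g) (root_of t) ->
  (forall s s' u, g s = Some u -> g s' = Some u -> s = s') ->
  is_plane_tree t.
Proof.
move=> ts te arb ginj; have aE := same_edges_adj te.
have pE x s : path (adj t) x s = path (symr (child_rel g)) x s by apply: eq_path.
(* The children read off from simple paths in the graph are those prescribed by [g]. *)
have childE v u : is_child t v u <-> child_rel g v u.
  split=> [[s []]|evu]; first by rewrite pE => ps us <-; apply: arb_simple_path.
  have [s [ps us su]] := arb_path arb u.
  case/lastP: s ps us su => [_ _ ur|s w].
    by move: evu; rewrite -ur /= (negPf (arb_root arb v)).
  rewrite last_rcons => + + wu; rewrite {w}wu => ps us.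
  exists s; rewrite pE; split=> //.
  exact: (arb_parent arb (arb_simple_path arb ps us) evu).
have slot_child v u : (slot t v u != None) = child_rel g v u.
  apply/idP/child_relP=> [|[p /ts->//]].
  by case E: (slot t v u) => [p|//] _; exists p; apply/ts.
have slotinj v : {in children t v &, injective (slot t v)}.
  move=> u w; rewrite !inE => /asboolP/childE; rewrite -slot_child => + _.
  case E: (slot t v u) => [p|//] _ /esym/ts gw; move/ts in E.
  by move: gw; rewrite E => -[].
have childrenE v u : (u \in children t v) = child_rel g v u.
  by rewrite inE; apply/asboolP/idP=> /childE.
split=> //.
- move=> e; rewrite te inE => /existsP[v /existsP[u /andP[evu /eqP->]]].
  by rewrite cards2; case: eqVneq evu => // ->; rewrite (negPf (arb_irr arb u)).
- have conn u : connect (adj t) (root_of t) u.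
    have [s [ps _ su]] := arb_path arb u; apply/connectP; exists s => //.
    by rewrite pE.
  move=> u v; apply: connect_trans (conn v).
  by rewrite (sym_connect_sym (@adj_sym t)).
- move=> c c2; have := arb_acyclic arb c2.
  by rewrite /ucycle (eq_cycle aE).
- move=> v; rewrite -(card_in_imset (@slotinj v)).
  apply: leq_trans (_ : #|[set Some p | p in [set: 'I_K.+1]]| <= K.+1); last first.
    by rewrite card_imset ?cardsT ?card_ord // => p q [].
  apply: subset_leq_card; apply/subsetP=> o /imsetP[u uc ->].
  move: uc; rewrite childrenE -slot_child; case: (slot t v u) => // p _.
  by apply/imsetP; exists p; rewrite ?inE.
- by move=> v u; rewrite slot_child childrenE.
Qed.

Lemma arborescence_of_plane_tree t : is_plane_tree t ->
  exists g, [/\ same_slots t g, same_edges t g, arborescence (child_rel g) (root_of t)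
    & forall s s' u, g s = Some u -> g s' = Some u -> s = s'].
Proof.
case=> e2 conn acyc _ sdom sinj.
have a_irr : irreflexive (adj t).
  by move=> x; apply/negP=> /e2; rewrite setUid cards1.
pose g : cmap := [ffun vp => [pick u | slot t vp.1 u == Some vp.2]].
have ts : same_slots t g.
  move=> v u p; rewrite ffunE /=; case: pickP => [w /eqP sw|sN].
    split=> [su|[<-//]]; congr Some; apply: (sinj v); rewrite -?sdom ?sw ?su //.
  by split=> // su; have := sN u; rewrite su eqxx.
have childE v u : child_of (adj t) (root_of t) v u <-> child_rel g v u.
  have -> : child_rel g v u = (slot t v u != None).
    apply/child_relP/idP=> [[p /ts->//]|].
    by case E: (slot t v u) => [p|//] _; exists p; apply/ts.
  by rewrite sdom inE; split=> [?|/asboolP//]; apply/asboolP.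
have parE v v' u : child_rel g v u -> child_rel g v' u -> v = v'.
  move=> /childE vu /childE v'u.
  exact: (child_parent (@adj_sym t) a_irr acyc vu v'u).
exists g; split=> //.
- apply/setP=> e; rewrite inE; apply/idP/existsP=> [eE|[v /existsP[u /andP[evu /eqP->]]]].
    have /eqP/cards2P[x [y [_ exy]]] := e2 _ eE.
    have axy : adj t x y by rewrite /adj -exy.
    have [/childE cxy|/childE cyx] := adj_child (root_of t) a_irr conn acyc axy.
      by exists x; apply/existsP; exists y; rewrite cxy exy eqxx.
    by exists y; apply/existsP; exists x; rewrite cyx exy setUC eqxx.
  by move/childE/child_adj: evu.
- split=> //; first by move=> v; apply/negP=> /childE/child_root.
  move=> W rW W0; have [v [u [vW /childE cvu uW]]] := child_enter conn rW W0.
  by exists v, u.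
- move=> [v p] [v' p'] u gu gu'.
  have vv : v = v'.
    by apply: (parE _ _ u); apply/child_relP; [exists p|exists p'].
  rewrite -{v'}vv in gu' *.
  by move/ts: gu; move/ts: gu' => ->  [->].
Qed.

Lemma rightmost_branchE t g : same_slots t g -> forall u,
  rightmost_branch t u <-> connect (right_rel g) (root_of t) u.
Proof.
move=> ts u; split.
  elim=> [//|v w p _ vc /ts gp pK]; apply: connect_trans vc _; apply: connect1.
  rewrite /right_rel; have -> : ord_max = p by apply: val_inj; case: pK.
  by rewrite gp.
case/connectP=> s ps ->; elim/last_ind: s ps => [_|s w IHs]; first exact: rightmost_root.
rewrite rcons_path last_rcons => /andP[/IHs sb /eqP gw].
by apply: rightmost_step sb _ _; [apply/ts; exact: gw|].
Qed.

(** * Counting root-minimal trees by their root *)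

Definition larger r : pred V := fun v => fsval r < fsval v.

Lemma root_minimalE t g : same_slots t g ->
  root_minimal t <-> right_branch_in (larger (root_of t)) (root_of t) g.
Proof.
move=> ts; split=> [rm|/forallP rb v /(rightmost_branchE ts) cv vr].
  apply/forallP=> v; apply/implyP=> /(rightmost_branchE ts) bv.
  by apply/implyP=> vr; apply: rm.
by have := rb v; rewrite cv vr.
Qed.

Definition min_forests r : {set cmap} :=
  forest_set (slots K r) [set~ r] (right_branch_in (larger r) r).

(** The bijection sends a root [r] and a child map [g] to [data_of r g]. *)
Lemma card_root_minimal_trees :
  #|root_minimal_trees K.+1 V| = \sum_(r : V) #|min_forests r|.
Proof.
pose A : {set V * cmap} := [set rg | rg.2 \in min_forests rg.1].
have -> : \sum_(r : V) #|min_forests r| = #|A|.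
  rewrite -sum1_card (partition_big fst predT) //=; apply: eq_bigr => r _.
  rewrite sum1_card -(card_imset (f := pair r) (mem (min_forests r))); last by move=> g h [].
  apply: eq_card => -[r' g]; rewrite [RHS]inE /= inE.
  apply/imsetP/andP=> [[h hm [-> ->]]|[gm /eqP <-]]; first by rewrite eqxx.
  by exists g.
rewrite -(card_in_imset (f := fun rg => data_of rg.1 rg.2) (D := mem A)); last first.
  move=> [r g] [r' g']; rewrite !inE /=.
  move=> /andP[/asboolP/forest_arborescence[_ gi] _] /andP[/asboolP/forest_arborescence[_ gi'] _].
  have sg := data_of_slots r gi; have sg' := data_of_slots r' gi'.
  move=> E; have rr : r = r' := congr1 (@root_of _ _) E; congr pair => //.
  rewrite E in sg; apply/ffunP=> -[v p].
  case F: (g (v, p)) => [u|]; first by move/sg/sg': F.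
  by case F': (g' (v, p)) => [u|//]; move/sg'/sg: F'; rewrite F.
apply: eq_card => t; rewrite !inE; apply/andP/imsetP.
  move=> [/asboolP pt /asboolP rm]; have [g [ts te arb gi]] := arborescence_of_plane_tree pt.
  exists (root_of t, g).
    rewrite !inE /=; apply/andP; split.
      by apply/asboolP/forest_arborescence.
    exact/(root_minimalE ts).
  rewrite /data_of /= -te; case: t pt rm ts te arb => [[E r] f] pt rm ts te arb.
  congr (_, _, _); apply/ffunP=> v; apply/ffunP=> u; rewrite !ffunE.
  have sE p : slot (E, r, f) v u = Some p <-> _ := ts v u p.
  rewrite /slot /= in sE; case: pickP => [p /eqP/sE->//|gN].
  case F: (f v u) => [p|//]; move/sE: F => F.
  by have := gN p; rewrite F eqxx.
case=> -[r g]; rewrite !inE /= => /andP[/asboolP/forest_arborescence[arb gi] rb] ->.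
have ts := data_of_slots r gi.
split; apply/asboolP; first exact: plane_tree_of_arborescence ts _ arb gi.
by apply/(root_minimalE ts).
Qed.

(** A right branch with [i] vertices below the root leaves [K] open slots at each of its [i.+1]
    vertices. *)
Lemma card_min_forests n r : #|{: V}| = n.+1 ->
  #|min_forests r| = \sum_(i < n.+1) #|[set u | larger r u]| ^_ i *
     ((n - i)`! * forests K.+1 (n - i) (K * i.+1)).
Proof.
move=> cV; have cU : #|[set~ r]| = n by rewrite cardsC1 cV.
have op : open_slots (slots K r) [set~ r].
  rewrite /open_slots slots_uniq; apply/allP=> s; rewrite mem_slots => /eqP->.
  by rewrite !inE negbK.
rewrite /min_forests (card_right_branch (larger r) cU op).
have -> : #|[set u in [set~ r] | larger r u]| = #|[set u | larger r u]|.
  apply: eq_card => u; rewrite !inE; apply: andb_idl; rewrite /larger.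
  by apply: contraTneq => ->; rewrite ltnn.
apply: eq_bigr => i _; congr (_ * (_ * forests _ _ _)).
have /eq_add_S -> : (size [seq (r, p) | p <- enum 'I_K.+1 & p != ord_max]).+1 = K.+1.
  exact: size_slots r.
by rewrite mulnS mulnC.
Qed.

End TreeEncoding.

(** * Summation over the root label *)

(** Discrete integration of falling factorials; it produces the proportion $1/(m+1)$ of branch
    orderings that start with the minimum. *)
Lemma sum_ffact m n : m.+1 * \sum_(a < n) a ^_ m = n ^_ m.+1.
Proof.
elim: n => [|n IHn]; first by rewrite big_ord0 muln0.
rewrite big_ord_recr mulnDr IHn /= ffactnSr ffactSS.
have [le_mn|lt_nm] := leqP m n; last by rewrite ffact_small // !muln0.
by nia.
Qed.

(** The root label [r] has [n - r] larger labels, so each value below [n] occurs exactly once. *)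
Lemma sum_larger n (F : nat -> nat) :
  \sum_(r : interval1 n) F #|[set u | larger r u]| = \sum_(a < n) F a.
Proof.
have sumE (H : nat -> nat) : \sum_(r : interval1 n) H (fsval r) = \sum_(1 <= a < n.+1) H a.
  rewrite -(big_seq_fsetE _ (interval1 n) xpredT H) /index_iota subSS subn0.
  apply: perm_big; apply: uniq_perm; rewrite ?fset_uniq ?iota_uniq //.
  by move=> x; rewrite inE.
transitivity (\sum_(r : interval1 n) F (n - fsval r)).
  apply: eq_bigr => r _; congr F.
  transitivity (\sum_(u : interval1 n) (fsval r < fsval u)).
    by rewrite -sum1dep_card big_mkcond; apply: eq_bigr => u _; rewrite /larger; case: ltnP.
  have rn : fsval r <= n by have := fsvalP r; rewrite inE mem_iota; lia.
  rewrite (sumE (fun u => fsval r < u : nat)) (big_cat_nat (n := (fsval r).+1)) //=.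
  rewrite big_nat big1 ?add0n => [|i /andP[_]]; last by rewrite ltnS ltnNge => ->.
  rewrite big_nat (eq_bigr (fun=> 1)) => [|i /andP[->]//].
  by rewrite -big_nat sum_nat_const_nat muln1 subSS.
rewrite (sumE (fun r => F (n - r))) big_add1 big_mkord /= (reindex_inj rev_ord_inj).
by apply: eq_bigr => i _; congr F; rewrite /= subnSK // subKn // ltnW.
Qed.

Lemma card_interval1 n : #|{: interval1 n}| = n.
Proof.
rewrite -cardfE -{2}(size_iota 1 n); apply/perm_size/uniq_perm.
- exact: fset_uniq.
- exact: iota_uniq.
- by move=> x; rewrite inE.
Qed.

(** * Generating functions *)

Local Open Scope ring_scope.

Lemma Gk_forests k n : (0 < k)%N -> Gk k n = (forests k n 1)%:R.
Proof.
move=> k0; case: n => [//|n]; rewrite /Gk /=.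
have E := forests_closed n.+1 1 k0; rewrite mul1n in E.
have E1 := mul_bin_left (k * n.+1) n; have E2 := mul_bin_diag (1 + k * n.+1) n.
have n0 : n.+1%:R != 0 :> rat by rewrite pnatr_eq0.
have N0 : (1 + k * n.+1)%:R != 0 :> rat by rewrite pnatr_eq0.
apply: (mulfI N0); rewrite -natrM E mulrA; apply: (mulIf n0).
by rewrite mulfVK // -!natrM ?mul1n [in RHS]mulnC; congr (_%:R); exact: E2.
Qed.

(* (G - 1)^m = x^m G^(km) *)
Lemma Gk_sub1_exp k m n : (0 < k)%N ->
  fps_exp (fps_sub (Gk k) fps_one) m n =
  if (m <= n)%N then (forests k (n - m) (k * m))%:R else 0.
Proof.
move=> k0; elim: m n => [|m IHm] n.
  rewrite /fps_exp /= /fps_one subn0 muln0; case: n => //= n.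
  by rewrite big_ord0.
rewrite /fps_exp /= -/(fps_exp _ m) /fps_mul big_ord_recl /=.
rewrite {1}/fps_sub {1}/Gk /fps_one /= subrr mul0r add0r.
case: n => [|n]; first by rewrite big_ord0.
(* One factor $G-1 = xG^k$ is split off. *)
transitivity (\sum_(i < n.+1) (forests k i k)%:R *
    (if (m <= n - i)%N then (forests k (n - i - m) (k * m))%:R else 0) : rat).
  apply: eq_bigr => i _; rewrite IHm /bump /= add1n subSS; congr (_ * _).
  rewrite /fps_sub Gk_forests // /fps_one /= subr0.
  by rewrite /= big_ord1 add0n.
rewrite ltnS subSS; case: leqP => [le_mn|lt_nm]; last first.
  apply: big1 => i _; rewrite ifF ?mulr0 //.
  by apply/negbTE; rewrite -ltnNge; apply: leq_ltn_trans lt_nm; rewrite leq_subr.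
rewrite mulnS -forests_conv // natr_sum.
have le1 : ((n - m).+1 <= n.+1)%N by rewrite ltnS leq_subr.
rewrite (big_ord_widen _ (fun i => (forests k i k * forests k (n - m - i) (k * m))%:R) le1).
rewrite [RHS]big_mkcond; apply: eq_bigr => i _.
have -> : (i < (n - m).+1)%N = (m <= n - i)%N by have := ltn_ord i; lia.
case: ifP; rewrite ?mulr0 // natrM => _.
by rewrite subnAC.
Qed.

(** The coefficient of $x^n$ in $(1+x)^{N+1}/(1+x)$; the induction is Pascal's rule. *)
Lemma alternating_bin N n :
  \sum_(i < n.+1) (-1) ^+ i * ('C(N.+1, n - i))%:R = ('C(N, n))%:R :> rat.
Proof.
elim: n => [|n IHn]; first by rewrite big_ord1 /= !bin0 mul1r.
rewrite big_ord_recl subn0 mul1r.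
under eq_bigr => i _ do rewrite /= /bump /= add1n subSS exprS mulN1r mulNr.
by rewrite sumrN IHn binS natrD addrK.
Qed.

Lemma hockey_stick a n : (\sum_(i < n.+1) 'C(a + i, i))%N = 'C((a + n).+1, n).
Proof.
elim: n => [|n IHn]; first by rewrite big_ord1 !bin0.
by rewrite big_ord_recr /= IHn addnS [RHS]binS addnC.
Qed.

Lemma log_Gk k n : (0 < k)%N ->
  fps_log (Gk k) n.+1 = ('C((k * n.+1).-1, n))%:R / n.+1%:R.
Proof.
move=> k0; rewrite /fps_log big_add1 big_mkord.
(* By the closed form, [forests k (n - i) (k * i.+1) / i.+1] equals ['C(k * n.+1, n - i) / n.+1];
   the upper index is written as a successor to match [alternating_bin]. *)
transitivity (\sum_(i < n.+1) (-1) ^+ i * ('C((k * n.+1).-1.+1, n - i))%:R / n.+1%:R : rat).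
  apply: eq_bigr => i _; rewrite Gk_sub1_exp // ltn_ord subSS /=.
  have := forests_closed (n - i) (k * i.+1) k0.
  rewrite -mulnDr addSn subnKC -1?ltnS // prednK ?muln_gt0 ?k0 // -!mulnA.
  move/eqP; rewrite eqn_pmul2l // => /eqP E.
  have i0 : i.+1%:R != 0 :> rat by rewrite pnatr_eq0.
  have n0 : n.+1%:R != 0 :> rat by rewrite pnatr_eq0.
  rewrite -!mulrA; congr (_ * _); apply: (mulfI i0); rewrite mulrA divff // mul1r.
  by apply: (mulIf n0); rewrite -!mulrA mulVf // mulr1 -!natrM mulnC E.
by rewrite -mulr_suml alternating_bin.
Qed.

Lemma sum_forests_right k n : (1 < k)%N ->
  \sum_(i < n.+1) (forests k (n - i) (k.-1 * i.+1))%:R / i.+1%:R =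
  ('C((k * n.+1).-1, n))%:R / n.+1%:R :> rat.
Proof.
case: k => [//|k] k1; rewrite ltnS in k1.
have k0 : (0 < k.+1)%N by [].
(* Here [k] is one less than the arity and still positive, so [k * n.+1 - 1] is a true difference.
   The closed form and absorption bring all summands to the denominator [n.+1]. *)
transitivity (\sum_(i < n.+1) ('C(k * n.+1 - 1 + (n - i), n - i))%:R / n.+1%:R : rat).
  apply: eq_bigr => i _; have lein : (i <= n)%N by rewrite -ltnS.
  have := forests_closed (n - i) (k * i.+1) k0.
  have -> : (k * i.+1 + k.+1 * (n - i) = k * n.+1 + (n - i))%N.
    by nia.
  have [M EM] : exists M, (k * n.+1 = M.+1)%N.
    by exists (k * n.+1).-1; rewrite prednK // muln_gt0 k1.
  rewrite /= EM subn1 /=; move: (n - i)%N (forests _ _ _) EM => d c EM E.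
  have E2 := mul_bin_down (M.+1 + d) d; rewrite /= addnK in E2.
  have i0 : i.+1%:R != 0 :> rat by rewrite pnatr_eq0.
  have n0 : n.+1%:R != 0 :> rat by rewrite pnatr_eq0.
  have M0 : (M.+1 + d)%:R != 0 :> rat by rewrite pnatr_eq0.
  apply: (mulfI M0); apply/eqP; rewrite !mulrA eqr_div // -!natrM E.
  by rewrite E2 -EM; apply/eqP; congr (_%:R); ring.
rewrite -mulr_suml -natr_sum; congr (_%:R / _).
rewrite (reindex_inj rev_ord_inj) /=.
transitivity (\sum_(i < n.+1) 'C(k * n.+1 - 1 + i, i))%N.
  by apply: eq_bigr => i _; rewrite subSS subKn // -ltnS.
rewrite hockey_stick; congr ('C(_, _)); nia.
Qed.

Lemma Gk_min_forests K n :
  Gk_min K.+1 n.+1 =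
  \sum_(i < n.+1) (forests K.+1 (n - i) (K * i.+1))%:R / i.+1%:R.
Proof.
rewrite /Gk_min card_root_minimal_trees.
rewrite (eq_bigr _ (fun r _ => card_min_forests K r (card_interval1 n.+1))).
rewrite (sum_larger n.+1 (fun a => \sum_(i < n.+1) a ^_ i *
     ((n - i)`! * forests K.+1 (n - i) (K * i.+1)))%N).
rewrite exchange_big natr_sum mulr_suml; apply: eq_bigr => i _.
rewrite -big_distrl /=.
have i0 : i.+1%:R != 0 :> rat by rewrite pnatr_eq0.
have f0 : n.+1`!%:R != 0 :> rat by rewrite pnatr_eq0 -lt0n fact_gt0.
apply/eqP; rewrite eqr_div // -!natrM; apply/eqP; congr (_%:R).
(* The sum over the roots times [i.+1] is [n.+1 ^_ i.+1], which [(n - i)!] completes to [n.+1!]. *)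
have := @ffact_fact n.+1 i.+1 (ltn_ord i); rewrite subSS -sum_ffact => <-.
by ring.
Qed.

Theorem theorem14 (k : nat) (hk : (2 <= k)%N) :
  fps_log (Gk k) =1 Gk_min k.
Proof.
case: k hk => [//|K] hk [|n]; first by rewrite /fps_log big_geq.
by rewrite log_Gk // Gk_min_forests -sum_forests_right.
Qed.
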